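(* Let $N_x,N_u,T$ be positive integers, $A\in\mathbb{R}^{N_x\times N_x}$, $B\in\mathbb{R}^{N_x\times N_u}$, and let a set of support constraints be given. Suppose there exists a closed-loop map $\phi$ satisfying the support constraints, the dynamics and the terminal condition $x(T)=0$, and that $$\operatorname{rank}(Z_h)=\operatorname{rank}(Z_hH).$$ Then for any convex cost function $f(\mathbf{x},\mathbf{u})$ of the state and input trajectories, the unconstrained optimal cost is achieved under the support constraints for (Lebesgue) almost every $x_0\in\mathbb{R}^{N_x}$, i.e. $$\inf_{(\mathbf{x},\mathbf{u})\in\mathcal{T}(x_0)}f(\mathbf{x},\mathbf{u})=\inf_{(\mathbf{x},\mathbf{u})\in\mathcal{S}(x_0)}f(\mathbf{x},\mathbf{u})\quad\text{for almost every }x_0 .$$ In particular, $V_c=Y_c^2$.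
   Context: $A^T$ denotes the $T$-th power of $A$; transposes are written $\top$. A closed-loop map is a matrix $\phi=[\phi_x;\phi_u]\in\mathbb{R}^{(N_x+N_u)T\times N_x}$, with $\phi_x$ the stack of $\phi_x(0),\dots,\phi_x(T-1)\in\mathbb{R}^{N_x\times N_x}$ and $\phi_u$ the stack of $\phi_u(0),\dots,\phi_u(T-1)\in\mathbb{R}^{N_u\times N_x}$. It satisfies the dynamics and the terminal condition if $\phi_x(0)=I$, $\phi_x(t+1)=A\phi_x(t)+B\phi_u(t)$ for $0\le t\le T-2$, and $A\phi_x(T-1)+B\phi_u(T-1)=0$; equivalently $Z_{AB0}\phi=[I;0]$, where $Z_{AB0}$ is the matrix with $T+1$ block rows of height $N_x$ and $(N_x+N_u)T$ columns such that, on a stacked vector $(x(0),\dots,x(T-1),u(0),\dots,u(T-1))$, block row $0$ gives $x(0)$, block row $t$ ($1\le t\le T-1$) gives $x(t)-Ax(t-1)-Bu(t-1)$, and block row $T$ gives $-Ax(T-1)-Bu(T-1)$. Support constraints: a given set of entries of $\phi$ (i.e. of $\phi_x$ and $\phi_u$) is required to be zero. For $i\in\{1,\dots,N_x\}$, $R_i$ is the set of row indices $j$ such that $\phi[j,i]$ is constrained to be zero. $\mathcal{S}(x_0)$ is the set of all trajectories $[\mathbf{x};\mathbf{u}]=(x(0),\dots,x(T-1),u(0),\dots,u(T-1))$ with $x(0)=x_0$, $x(t+1)=Ax(t)+Bu(t)$ for $0\le t\le T-1$, and $x(T)=0$ (no support constraints). $\mathcal{T}(x_0)$ is the set of trajectories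 $\phi x_0$ where $\phi$ ranges over all closed-loop maps satisfying the dynamics, the terminal condition and the support constraints. With $\dagger$ the Moore–Penrose pseudoinverse: $Z_h=I-Z_{AB0}^\dagger Z_{AB0}$; $Z_h[R_i]$ is the submatrix of $Z_h$ formed by the rows indexed by $R_i$; $H_i=I-Z_h[R_i]^\dagger Z_h[R_i]$; and $H=[H_1,\dots,H_{N_x}]$. Classical controllability: $V_c=\det\big(\sum_{i=0}^{T-1}A^iBB^\top(A^\top)^i\big)$. Constrained controllability: $Y_c=\mathrm{volume}\{A^Tx_0 : x_0\in\mathbb{R}^{N_x},\ h_c(x_0)\le 1\}$, where $h_c(x_0)=\min x_0^\top\big(\sum_{i=0}^{T-1}\phi_u(i)^\top\phi_u(i)\big)x_0$ over all closed-loop maps $\phi$ satisfying the dynamics, the terminal condition and the support constraints. Here $\mathrm{volume}$ is Lebesgue measure on $\mathbb{R}^{N_x}$ normalized so that the Euclidean unit ball has volume $1$.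
   Formalization: The final identity V_c = Y_c² is proved only for invertible A; for singular A one has Y_c = 0, so it can fail (e.g. N_x = N_u = T = 1, A = 0, B = 1 gives V_c = 1, Y_c = 0). The equality of optimal costs is proved without this assumption. *)

(* Defs.v *)
From HB Require Import structures.
From mathcomp Require Import all_boot all_order all_algebra.
From mathcomp Require Import all_classical all_reals all_analysis.

Set Implicit Arguments.
Unset Strict Implicit.
Unset Printing Implicit Defensive.

Import Order.TTheory GRing.Theory Num.Theory.
Import numFieldNormedType.Exports.

Local Open Scope classical_set_scope.
Local Open Scope ring_scope.

Section Pseudoinverse.
Context {R : realType}.

Definition is_pinv m n (M : 'M[R]_(m, n)) (X : 'M[R]_(n, m)) : Prop :=
  [/\ M *m X *m M = M, X *m M *m X = X,
      (M *m X)^T = M *m X & (X *m M)^T = X *m M].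

Definition pinv m n (M : 'M[R]_(m, n)) : 'M[R]_(n, m) := xget 0 (is_pinv M).

Lemma is_pinv_uniq m n (M : 'M[R]_(m, n)) X Y :
  is_pinv M X -> is_pinv M Y -> X = Y.
Proof.
move=> [MXM XMX MXs XMs] [MYM YMY MYs YMs].
have EMX : M *m X = M *m Y.
  have E : M *m X = (M *m Y) *m (M *m X) by rewrite mulmxA MYM.
  by rewrite -MXs E trmx_mul MXs MYs mulmxA MXM.
have EXM : X *m M = Y *m M.
  have E : X *m M = (X *m M) *m (Y *m M) by rewrite -mulmxA (mulmxA M) MYM.
  by rewrite -XMs E trmx_mul XMs YMs -mulmxA (mulmxA M) MXM.
by rewrite -XMX EXM -mulmxA EMX mulmxA YMY.
Qed.

Lemma gram_unitmx m n (M : 'M[R]_(m, n)) : row_free M -> M *m M^T \in unitmx.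
Proof.
move=> fM; rewrite -row_free_unit -kermx_eq0; apply/rowV0P => v.
move=> /sub_kermxP /(congr1 (mulmx^~ v^T)); rewrite mul0mx mulmxA => vM0.
suff : v *m M = 0 by move/eqP; rewrite mulmx_free_eq0// => /eqP.
have {}vM0 : \sum_j (v *m M) 0 j ^+ 2 = 0.
  transitivity (((v *m M) *m (v *m M)^T) 0 0).
    by rewrite [RHS]mxE; apply: eq_bigr => j _; rewrite [X in _ * X]mxE.
  by rewrite trmx_mul mulmxA -(mulmxA v) mulmxA vM0 mxE.
apply/rowP => j; rewrite [RHS]mxE; apply/eqP; rewrite -sqrf_eq0.
by move/eqP: vM0; rewrite psumr_eq0 => [/allP/(_ j)/= ->//|i _];
  rewrite ?mem_index_enum ?sqr_ge0.
Qed.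

Lemma pinvP m n (M : 'M[R]_(m, n)) : is_pinv M (pinv M).
Proof.
apply: xgetPex.
have [r [C [F [fC fF MCF]]]] : exists (r : nat) (C : 'M[R]_(m, r)) (F : 'M[R]_(r, n)),
    [/\ row_free C^T, row_free F & M = C *m F].
  exists (\rank M), (col_base M), (row_base M); split.
  - by rewrite /row_free mxrank_tr; exact: col_base_full.
  - exact: row_base_free.
  - by rewrite mulmx_base.
pose G := invmx (F *m F^T); pose K := invmx (C^T *m C).
have uF : F *m F^T \in unitmx by exact: gram_unitmx.
have uC : C^T *m C \in unitmx by rewrite -{2}[C]trmxK gram_unitmx.
have FG : F *m F^T *m G = 1%:M by rewrite mulmxV.
have KC : K *m (C^T *m C) = 1%:M by rewrite mulVmx.
have Gs : G^T = G by rewrite /G trmx_inv trmx_mul trmxK.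
have Ks : K^T = K by rewrite /K trmx_inv trmx_mul trmxK.
pose X := F^T *m G *m K *m C^T.
have MX : M *m X = C *m K *m C^T.
  rewrite /X MCF -!mulmxA; congr (C *m _).
  by rewrite !mulmxA FG mul1mx.
have XM : X *m M = F^T *m G *m F.
  rewrite /X MCF -!mulmxA; congr (F^T *m (G *m _)).
  by rewrite !mulmxA -(mulmxA K) KC mul1mx.
exists X; split.
- rewrite MX MCF -!mulmxA; congr (C *m _).
  by rewrite !mulmxA -(mulmxA K) KC mul1mx.
- rewrite XM /X -!mulmxA; congr (F^T *m (G *m _)).
  by rewrite !mulmxA FG mul1mx.
- by rewrite MX !trmx_mul trmxK Ks mulmxA.
- by rewrite XM !trmx_mul trmxK Gs mulmxA.
Qed.

End Pseudoinverse.

Section Lebesgue.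
Context {R : realType}.
Local Notation RT := (measurableTypeR R).

Section cons.
Variables (n : nat) (mu : {sigma_finite_measure set (n.-tuple RT) -> \bar R}).

Definition tuple_of_pair (p : RT * n.-tuple RT) : n.+1.-tuple RT :=
  [tuple of p.1 :: p.2].

Lemma measurable_tuple_of_pair : measurable_fun setT tuple_of_pair.
Proof. exact: measurable_cons. Qed.

Definition lebesgue_cons : set (n.+1.-tuple RT) -> \bar R :=
  pushforward (lebesgue_measure \x mu)%E tuple_of_pair.

Let lebesgue_cons0 : lebesgue_cons set0 = 0%E.
Proof. by rewrite /lebesgue_cons /pushforward preimage_set0 measure0. Qed.

Let lebesgue_cons_ge0 A : (0 <= lebesgue_cons A)%E.
Proof. by rewrite /lebesgue_cons /pushforward measure_ge0. Qed.

Let lebesgue_cons_sigma_additive : semi_sigma_additive lebesgue_cons.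
Proof.
move=> F mF tF mUF; rewrite /lebesgue_cons /pushforward preimage_bigcup.
have mp A : measurable A -> measurable (tuple_of_pair @^-1` A).
  by move=> mA; rewrite -[X in measurable X]setTI; exact: measurable_tuple_of_pair.
apply: measure_semi_sigma_additive.
- by move=> i; exact: mp.
- apply/trivIsetP => i j _ _ ij; rewrite -preimage_setI.
  by move/trivIsetP : tF => ->//; rewrite preimage_set0.
- by rewrite -preimage_bigcup; exact: mp.
Qed.

HB.instance Definition _ := isMeasure.Build _ _ _ lebesgue_cons
  lebesgue_cons0 lebesgue_cons_ge0 lebesgue_cons_sigma_additive.

Let lebesgue_cons_sigma_finite : sigma_finite setT lebesgue_cons.
Proof.
have /sigma_finiteP[F [TF ndF Foo]] := sigma_finiteT (@lebesgue_measure R).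
have /sigma_finiteP[G [TG ndG Goo]] := sigma_finiteT mu.
pose split_tuple (t : n.+1.-tuple RT) : RT * n.-tuple RT :=
  (thead t, [tuple of behead t]).
have msplit : measurable_fun setT split_tuple.
  apply/measurable_fun_pairP; split; first exact: measurable_tnth.
  exact: measurable_behead.
have splitK p : split_tuple (tuple_of_pair p) = p.
  by case: p => x t; congr (_, _); exact/val_inj.
exists (fun k => split_tuple @^-1` (F k `*` G k)).
  rewrite -preimage_bigcup; apply/seteqP; split => // t _.
  have [i _ Fi] : (\bigcup_i F i) (split_tuple t).1 by rewrite -TF.
  have [j _ Gj] : (\bigcup_i G i) (split_tuple t).2 by rewrite -TG.
  exists (maxn i j) => //; split.
    by move: Fi; exact/subsetPset/ndF/leq_maxl.
  by move: Gj; exact/subsetPset/ndG/leq_maxr.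
move=> k; have [[mF Fk] [mG Gk]] := (Foo k, Goo k); split.
  by rewrite -[X in measurable X]setTI; apply: msplit => //; exact: measurableX.
rewrite /lebesgue_cons /pushforward.
rewrite (_ : _ @^-1` _ = F k `*` G k); last first.
  by apply/funext => p; rewrite -[in RHS](splitK p).
by rewrite product_measure1E// lte_mul_pinfty// ge0_fin_numE.
Qed.

HB.instance Definition _ := Measure_isSigmaFinite.Build _ _ _ lebesgue_cons
  lebesgue_cons_sigma_finite.

End cons.

(* The [n]-fold product of the Lebesgue measure on the line. *)
Fixpoint lebesgue_tuple n : {sigma_finite_measure set (n.-tuple RT) -> \bar R} :=
  match n with
  | 0 => \d_ [tuple]
  | n'.+1 => lebesgue_cons (lebesgue_tuple n')
  end.

End Lebesgue.

Section EuclideanSpace.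
Context {R : realType} {n : nat}.

Definition colvec (t : n.-tuple (measurableTypeR R)) : 'cV[R]_n :=
  \col_i tnth t i.

Definition unit_ball : set 'cV[R]_n := [set x | (x^T *m x) 0 0 <= 1].

(* [lebesgue_tuple n] is only meaningful on Borel sets; the outer measure it
   induces coincides with the (complete) Lebesgue measure on every Lebesgue
   measurable set. *)
Definition lebesgue_vol (E : set 'cV[R]_n) : \bar R :=
  mu_ext (lebesgue_tuple n) (colvec @^-1` E).

(* Normalized so that the Euclidean unit ball has volume 1. *)
Definition volume (E : set 'cV[R]_n) : \bar R :=
  (lebesgue_vol E * ((fine (lebesgue_vol unit_ball))^-1)%:E)%E.

End EuclideanSpace.

Section ClosedLoop.
Context {R : realType} (Nx Nu T : nat) (A : 'M[R]_Nx) (B : 'M[R]_(Nx, Nu)).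

Local Notation dim := (\sum_(t < T) Nx + \sum_(t < T) Nu)%N.

(* A stack [x(0); ...; x(T-1); u(0); ...; u(T-1)] has [k] columns: [k = 1] for a
   trajectory and [k = Nx] for a closed-loop map. *)
Section Stack.
Variable k : nat.
Implicit Types phi : 'M[R]_(dim, k).

Definition state phi (t : 'I_T) : 'M[R]_(Nx, k) := submxcol (usubmx phi) t.

Definition input phi (t : 'I_T) : 'M[R]_(Nu, k) := submxcol (dsubmx phi) t.

(* The last clause, at [t = T - 1], is the terminal condition [x(T) = 0]. *)
Definition steers (init : 'M[R]_(Nx, k)) phi : Prop :=
  [/\ forall t : 'I_T, t = 0%N :> nat -> state phi t = init,
      forall s t : 'I_T, s = t.+1 :> nat ->
        state phi s = A *m state phi t + B *m input phi t &
      forall t : 'I_T, t.+1 = T -> A *m state phi t + B *m input phi t = 0].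

End Stack.

(* [C] is the set of entries of a closed-loop map that are required to be 0. *)
Variable C : {set 'I_dim * 'I_Nx}.

Definition closed_loop (phi : 'M[R]_(dim, Nx)) : Prop :=
  steers 1%:M phi /\ forall j i, (j, i) \in C -> phi j i = 0.

Definition trajS (x0 : 'cV[R]_Nx) : set 'cV[R]_dim := [set v | steers x0 v].

Definition trajT (x0 : 'cV[R]_Nx) : set 'cV[R]_dim :=
  [set phi *m x0 | phi in closed_loop].

Definition ZAB0 : 'M[R]_(\sum_(s < T.+1) Nx, dim) :=
  row_mx
    (\mxblock_(s < T.+1, t < T)
       ((if s == t :> nat then 1%:M else 0)
        - (if s == t.+1 :> nat then A else 0)))
    (\mxblock_(s < T.+1, t < T) (if s == t.+1 :> nat then - B else 0)).

Definition Zh : 'M[R]_dim := 1%:M - pinv ZAB0 *m ZAB0.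

Definition Rset (i : 'I_Nx) : {set 'I_dim} := [set j | (j, i) \in C].

Definition Zh_rows (i : 'I_Nx) : 'M[R]_(#|Rset i|, dim) :=
  rowsub (fun k : 'I_#|Rset i| => enum_val k) Zh.

Definition Hblock (i : 'I_Nx) : 'M[R]_dim :=
  1%:M - pinv (Zh_rows i) *m Zh_rows i.

Definition Hmx : 'M[R]_(dim, \sum_(i < Nx) dim) := \mxrow_(i < Nx) Hblock i.

Definition Vc : R := \det (\sum_(i < T) A ^+ i *m B *m B^T *m A^T ^+ i).

Definition hc_cost (x0 : 'cV[R]_Nx) (phi : 'M[R]_(dim, Nx)) : R :=
  (x0^T *m (\sum_(i < T) (input phi i)^T *m input phi i) *m x0) 0 0.

(* The infimum is a minimum (a convex quadratic over an affine space) as soon as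
   some [phi] is feasible; it is +oo otherwise. *)
Definition hc (x0 : 'cV[R]_Nx) : \bar R :=
  ereal_inf [set (hc_cost x0 phi)%:E | phi in closed_loop].

Definition Yc : \bar R :=
  volume [set A ^+ T *m x0 | x0 in [set x0 | (hc x0 <= 1)%E]].

End ClosedLoop.

Arguments trajS {R Nx Nu} T A B x0.

(* Main.v *)
Require Import Defs.
From HB Require Import structures.
From mathcomp Require Import all_boot all_order all_algebra.
From mathcomp Require Import all_classical all_reals all_analysis.
From mathcomp Require Import measurable_realfun ring lra.

Set Implicit Arguments.
Unset Strict Implicit.
Unset Printing Implicit Defensive.

Import Order.TTheory GRing.Theory Num.Theory.
Import numFieldNormedType.Exports.

Local Open Scope classical_set_scope.
Local Open Scope ring_scope.

(** Write Z, Z_h, H_i for the matrices of the statement and W_i for the column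
    space of Z_h H_i.

    The columns of a closed-loop map can be perturbed independently of each
    other.  The matrix Z_h is a projection onto the kernel of Z, and H_i is a
    projection onto the vectors v such that Z_h v vanishes on the rows
    constrained in column i; hence W_i is exactly the set of admissible
    perturbations of column i.  Starting from one feasible map phi0, the
    trajectories reachable under the constraints are therefore
    phi0 x0 + sum_i x0_i W_i, and as soon as no coordinate of x0 vanishes the
    scalars x0_i are absorbed by the subspaces W_i: the set is phi0 x0 plus the
    column space of Z_h H.  The rank hypothesis says that this is the column
    space of Z_h, that is, the kernel of Z, so that T(x0) = S(x0)
    (trajT_eq_trajS).  The two infima then coincide for any cost, outside the
    union of the coordinate hyperplanes, which is Lebesgue-null
    (negligible_row_zero).

    For the volume identity, transposition is written ^t.  Let K = [A^(T-1) B, ..., A B, B], so that the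
    Gramian is G = K K^t, and put y = A^T x0 (the T-th power of A).  A trajectory
    from x0 reaches 0 at time T exactly when its stacked input u satisfies
    K u = - y (steers_reach_mx, steers_of_input); the least energy of such an
    input is y^t G^-1 y (least_norm_le, least_norm_cost).  Since T(x0) is
    contained in S(x0), with equality when no coordinate of x0 vanishes, the set
    whose volume is Y_c lies inside the ellipsoid y^t G^-1 y <= 1 and contains
    it up to a null set.  With a Cholesky factorization G = L L^t (cholesky),
    this ellipsoid is the image of the unit ball under the lower triangular
    matrix L, and triangular changes of variables in the iterated Lebesgue
    measure follow from the affine change of variables on the line by slicing
    along the first coordinate (lebesgue_tuple_trig).  So Y_c = det L and
    Y_c^2 = det G = V_c (volume_ellipsoid). *)

(** * Affine changes of variable on the line *)

Section AffineLine.
Context {R : realType}.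
Local Notation RT := (measurableTypeR R).

Lemma measurable_affine (l b : R) :
  measurable_fun [set: RT] (fun x : RT => l * x + b : RT).
Proof. by apply: measurable_funD => //; exact: measurable_funM. Qed.

(** Both sides are measures of X, and they agree on half-open intervals. *)
Lemma lebesgue_measure_affine (l b : R) (X : set RT) : 0 < l -> measurable X ->
  (l%:E * lebesgue_measure ((fun x : RT => (l * x + b)%R : RT) @^-1` X) = lebesgue_measure X)%E.
Proof.
move=> l0 mX.
have ln0 : l != 0 by rewrite gt_eqF.
pose g : RT -> RT := fun x => l * x + b.
pose mg : measurable_fun [set: RT] g := measurable_affine l b.
pose gm : {mfun RT >-> RT} := HB.pack g (isMeasurableFun.Build _ _ _ _ _ mg).
have -> : g @^-1` X = gm @^-1` X by [].
pose ln := NngNum (ltW l0).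
rewrite [RHS](@lebesgue_measure_unique R (mscale ln (pushforward lebesgue_measure gm)))//.
move=> _ [[c d]] _ <-.
pose I : set RT := `](c - b) / l, (d - b) / l]%classic.
have gE : g @^-1` `]c, d] = I.
  apply/seteqP; split=> x /=; rewrite /I /= !in_itv/= /g ltr_pdivrMr// ler_pdivlMr//;
    by move=> /andP[? ?]; apply/andP; split; lra.
transitivity (l%:E * lebesgue_measure I)%E;
  last by rewrite -gE.
rewrite /I !lebesgue_measure_itv/= !lte_fin.
rewrite ltr_pM2r ?invr_gt0// ltrD2r.
case: ifP => _; last by rewrite mule0.
by rewrite -!EFinB -EFinM; congr (_%:E); field.
Qed.

Lemma ge0_integral_affine (l b : R) (f : RT -> \bar R) : 0 < l ->
  measurable_fun [set: RT] f -> (forall x, 0 <= f x)%E ->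
  (\int[lebesgue_measure]_x f (l * x + b)%R = l^-1%:E * \int[lebesgue_measure]_x f x)%E.
Proof.
move=> l0 mf f0.
have ln0 : l != 0 by rewrite gt_eqF.
pose g : RT -> RT := fun x => l * x + b.
have mg : measurable_fun [set: RT] g := measurable_affine l b.
pose gm : {mfun RT >-> RT} := HB.pack g (isMeasurableFun.Build _ _ _ _ _ mg).
have li0 : 0 <= l^-1 by rewrite invr_ge0 ltW.
rewrite -(@ge0_integral_mscale _ _ _ lebesgue_measure _ measurableT (NngNum li0))//.
have -> : (\int[lebesgue_measure]_x f (l * x + b)%R =
           \int[pushforward lebesgue_measure gm]_x f x)%E.
  by rewrite ge0_integral_pushforward.
apply: eq_measure_integral => //= Y mY _.
rewrite /mscale /pushforward /= -(lebesgue_measure_affine b l0 mY) muleA -EFinM.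
by rewrite mulVf// mul1e.
Qed.

End AffineLine.

(** * Slicing the iterated Lebesgue measure *)

Section LebesgueTuple.
Context {R : realType}.
Local Notation RT := (measurableTypeR R).

(** Cavalieri: the inductive steps below all compare slices at a fixed first
    coordinate. *)
Lemma lebesgue_tupleS n (S : set (n.+1.-tuple RT)) :
  (lebesgue_tuple n.+1 S =
   \int[lebesgue_measure]_x lebesgue_tuple n [set t | S (tuple_of_pair (x, t))])%E.
Proof.
rewrite [LHS]/= /lebesgue_cons /pushforward /product_measure1.
apply: eq_integral => x _ /=; congr (lebesgue_tuple n _).
by apply/seteqP; split => t; rewrite /xsection /= inE.
Qed.

Lemma measurable_section n (S : set (n.+1.-tuple RT)) (x : RT) :
  measurable S -> measurable [set t | S (tuple_of_pair (x, t))].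
Proof.
move=> mS; rewrite (_ : [set t | _] = xsection (@tuple_of_pair R n @^-1` S) x).
  apply: measurable_xsection; rewrite -[X in measurable X]setTI.
  exact: measurable_tuple_of_pair.
by apply/seteqP; split => t; rewrite /xsection /= inE.
Qed.

Lemma measurable_fun_section n (S : set (n.+1.-tuple RT)) : measurable S ->
  measurable_fun [set: RT] (fun x => lebesgue_tuple n [set t | S (tuple_of_pair (x, t))]).
Proof.
move=> mS; rewrite (_ : (fun x => _) =
    lebesgue_tuple n \o xsection (@tuple_of_pair R n @^-1` S)).
  apply: measurable_fun_xsection; rewrite -[X in measurable X]setTI.
  exact: measurable_tuple_of_pair.
apply/funext => x /=; congr (lebesgue_tuple n _).
by apply/seteqP; split => t; rewrite /xsection /= inE.
Qed.

Lemma colvec_cons n (x : R) (t : n.-tuple RT) :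
  colvec (tuple_of_pair (x, t)) = col_mx (x%:M : 'M[R]_1) (colvec t) :> 'cV_(1 + n).
Proof.
apply/colP => i; rewrite [LHS]mxE; case: (split_ordP i) => j ->.
  rewrite col_mxEu ord1 mxE mulr1n [X in tnth _ X](_ : _ = ord0) ?tnth0//.
  exact/val_inj.
rewrite col_mxEd mxE [X in tnth _ X](_ : _ = lift ord0 j) ?tnthS//.
exact/val_inj.
Qed.

(** For a lower triangular map, the first coordinate of the image depends only on
    the first coordinate of the argument, and each slice is transformed by the
    lower right block of L, up to a translation that depends on the slice; this
    is why the statement is about affine maps. *)
Lemma lebesgue_tuple_trig n (L : 'M[R]_n) (b : 'cV[R]_n) (E : set 'cV[R]_n) :
  is_trig_mx L -> (forall i, 0 < L i i) -> measurable (colvec @^-1` E) ->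
  (lebesgue_tuple n (colvec @^-1` [set v | E (L *m v + b)%R]) =
   ((\det L)^-1)%:E * lebesgue_tuple n (colvec @^-1` E))%E.
Proof.
elim: n => [|n IHn] in L b E *.
  move=> _ _ _; rewrite det_mx00 invr1 mul1e; congr (lebesgue_tuple 0 _).
  by apply/seteqP; split => t /=; rewrite [_ + b]flatmx0 [colvec t]flatmx0.
rewrite -[n.+1]/(1 + n)%N in L b E *.
move=> trL posL mE.
pose l := L ord0 ord0; pose c : 'cV[R]_n := dlsubmx L; pose L' : 'M[R]_n := drsubmx L.
pose b0 := b ord0 ord0; pose b' : 'cV[R]_n := dsubmx b.
have ultr : ulsubmx L = l%:M.
  apply/matrixP => i j; rewrite !ord1 !mxE /= mulr1n /l; congr (L _ _); exact/val_inj.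
have EL : L = block_mx l%:M 0 c L'.
  rewrite -[L in LHS]submxK ultr; congr (block_mx _ _ _ _).
  apply/matrixP => i j; rewrite [LHS]mxE mxE [RHS]mxE.
  apply: (is_trig_mxP trL) => /=.
  by rewrite ord1 /= add1n.
have Eb : b = col_mx b0%:M b'.
  rewrite -[b in LHS]vsubmxK; congr col_mx.
  apply/matrixP => i j; rewrite !ord1 !mxE /= mulr1n /b0; congr (b _ _); exact/val_inj.
have l0 : 0 < l by exact: posL.
have trL' : is_trig_mx L'.
  apply/is_trig_mxP => i j ij; rewrite !mxE; apply: (is_trig_mxP trL).
  by rewrite /= ltn_add2l.
have posL' i : 0 < L' i i by rewrite !mxE.
have detL : \det L = l * \det L' by rewrite EL det_lblock det_scalar1.
pose Ex x : set 'cV[R]_n := [set v | E (col_mx x%:M v)].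
have mEx x : measurable (colvec @^-1` Ex x).
  rewrite (_ : _ @^-1` _ =
      [set t | (colvec @^-1` E : set (n.+1.-tuple RT)) (tuple_of_pair (x, t))]).
    exact: measurable_section.
  by apply/seteqP; split => t /=; rewrite colvec_cons.
pose g x := lebesgue_tuple n (colvec @^-1` Ex x).
have gE : (fun x => lebesgue_tuple n
    [set t | (colvec @^-1` E : set (n.+1.-tuple RT)) (tuple_of_pair (x, t))]) = g.
  apply/funext => x; rewrite /g; congr (lebesgue_tuple n _).
  by apply/seteqP; split => t /=; rewrite colvec_cons.
have mg : measurable_fun [set: RT] g.
  by rewrite -gE; exact: measurable_fun_section.
have affE x (v : 'cV[R]_n) : L *m col_mx x%:M v + b =
    col_mx (l * x + b0)%:M (L' *m v + (x *: c + b')).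
  rewrite EL Eb mul_block_col add_col_mx mul0mx addr0 -scalar_mxM -raddfD/=.
  by rewrite mul_mx_scalar addrA [L' *m v + _]addrC.
rewrite lebesgue_tupleS [in RHS]lebesgue_tupleS gE.
transitivity (\int[lebesgue_measure]_x ((\det L')^-1%:E * g (l * x + b0)%R))%E.
  apply: eq_integral => x _; rewrite /g -(IHn L' (x *: c + b'))//.
  congr (lebesgue_tuple n _); apply/seteqP.
  by split => t /=; rewrite colvec_cons affE.
have detL'0 : 0 < \det L' by rewrite det_trig// prodr_gt0.
rewrite ge0_integralZl//; last 2 first.
- by apply: (measurableT_comp mg); exact: measurable_affine.
- by rewrite lee_fin invr_ge0 ltW.
by rewrite ge0_integral_affine// muleA -EFinM detL invfM mulrC.
Qed.

End LebesgueTuple.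

(** * Null sets and the Euclidean ball *)

Section NullAndBall.
Context {R : realType}.
Local Notation RT := (measurableTypeR R).

Lemma measurable_quadratic_form n (M : 'M[R]_n) :
  measurable_fun [set: n.-tuple RT]
    (fun t => ((colvec t)^T *m M *m colvec t) 0 0 : RT).
Proof.
have -> : (fun t : n.-tuple RT => ((colvec t)^T *m M *m colvec t) 0 0) =
    (fun t => \sum_j (\sum_i tnth t i * M i j) * tnth t j).
  apply/funext => t; rewrite mxE; apply: eq_bigr => j _; rewrite !mxE.
  by congr (_ * _); apply: eq_bigr => i _; rewrite !mxE.
apply: measurable_sum => j; apply: measurable_funM; last exact: measurable_tnth.
by apply: measurable_sum => i; apply: measurable_funM => //; exact: measurable_tnth.
Qed.

Lemma measurable_sublevel n (M : 'M[R]_n) :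
  measurable (colvec @^-1` [set v | (v^T *m M *m v) 0 0 <= 1] : set (n.-tuple RT)).
Proof.
have := measurable_quadratic_form M measurableT (measurable_itv `]-oo, (1 : R)]).
by rewrite setTI; congr measurable.
Qed.

(** If r has a nonzero entry after the first one, every slice is a hyperplane of
    the smaller space; otherwise the set is a cylinder over a single point of the
    line. *)
Lemma lebesgue_tuple_hyperplane n (r : 'rV[R]_n) (a : R) : r != 0 ->
  lebesgue_tuple n (colvec @^-1` [set v | (r *m v) 0 0 = a]) = 0%E.
Proof.
elim: n => [|n IHn] in r a *; first by rewrite thinmx0 eqxx.
rewrite -[n.+1]/(1 + n)%N in r *.
rewrite -[r]hsubmxK; move: (lsubmx r) (rsubmx r) => r0 r' r_neq0.
have rE (x : R) (t : n.-tuple RT) :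
    (row_mx r0 r' *m colvec (tuple_of_pair (x, t) : n.+1.-tuple RT)) 0 0 =
    r0 0 0 * x + (r' *m colvec t) 0 0.
  by rewrite colvec_cons mul_row_col mul_mx_scalar !mxE mulrC.
have [r'0|r'_neq0] := eqVneq r' 0; last first.
  rewrite lebesgue_tupleS integral0_eq// => x _.
  rewrite (_ : [set t | _] = colvec @^-1` [set v | (r' *m v) 0 0 = a - r0 0 0 * x]).
    exact: IHn.
  by apply/seteqP; split => t /=; rewrite rE; [move=> <-|move=> ->];
    rewrite addrC ?addKr// subrK.
have r00 : r0 0 0 != 0.
  apply: contra_neq r_neq0 => r00; rewrite r'0 [r0](_ : _ = 0) ?row_mx0//.
  by apply/matrixP => i j; rewrite !ord1 r00 mxE.
rewrite [LHS]/= /lebesgue_cons /pushforward.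
rewrite (_ : _ @^-1` _ = [set a / r0 0 0] `*` [set: n.-tuple RT]).
  by rewrite product_measure1E// [X in (X * _)%E]lebesgue_measure_set1 mul0e.
apply/seteqP; split => -[x t] /=; rewrite rE r'0 mul0mx mxE addr0.
  by move=> <-; split=> //; rewrite mulrAC mulfV// mul1r.
by move=> [-> _]; rewrite mulrCA mulfV// mulr1.
Qed.

Lemma measurable_hyperplane n (r : 'rV[R]_n) (a : R) :
  measurable (colvec @^-1` [set v | (r *m v) 0 0 = a] : set (n.-tuple RT)).
Proof.
have mr : measurable_fun [set: n.-tuple RT] (fun t => (r *m colvec t) 0 0 : RT).
  have -> : (fun t : n.-tuple RT => (r *m colvec t) 0 0) =
      (fun t => \sum_j r 0 j * tnth t j).
    by apply/funext => t; rewrite mxE; apply: eq_bigr => j _; rewrite mxE.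
  by apply: measurable_sum => j; apply: measurable_funM => //; exact: measurable_tnth.
by have := mr measurableT _ (measurable_set1 a); rewrite setTI.
Qed.

Lemma negligible_row_zero n (D : 'M[R]_n) : D \in unitmx ->
  (lebesgue_tuple n).-negligible
    (colvec @^-1` [set v | exists i, (D *m v) i 0 = 0]).
Proof.
move=> uD.
(* Countable unions are at hand, so the rows are indexed by natural numbers. *)
pose F k : set (n.-tuple RT) :=
  [set t | exists2 i : 'I_n, i = k :> nat & (D *m colvec t) i 0 = 0].
apply: (@negligibleS _ _ _ _ (\bigcup_k F k)) => [t [i Dti]|]; first by exists i => //; exists i.
apply: negligible_bigcup => k.
have [kn|nk] := ltnP k n; last first.
  apply: (negligibleS _ (negligible_set0 _)) => t [i ik _].
  by move: nk; rewrite -ik leqNgt ltn_ord.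
pose r := row (Ordinal kn) D.
apply: (@negligibleS _ _ _ _ (colvec @^-1` [set v | (r *m v) 0 0 = 0])).
  move=> t [i ik Dt0]; rewrite /r /= -row_mul mxE.
  by rewrite (_ : Ordinal kn = i)//; exact/val_inj.
apply/negligibleP; first exact: measurable_hyperplane.
apply: lebesgue_tuple_hyperplane; apply: contraTneq uD => r0.
apply/negP => uD; have := row_free_unit D; rewrite uD => /row_freeP[E DE].
have := congr1 (row (Ordinal kn)) DE; rewrite row_mul -/r r0 mul0mx.
by move=> /rowP/(_ (Ordinal kn)); rewrite !mxE eqxx => /eqP; rewrite eq_sym oner_eq0.
Qed.

(** The sup-norm ball, whose measure is a product, serves to bound the measure of
    the Euclidean ball from both sides. *)
Definition cube (n : nat) (c : R) : set (n.-tuple RT) := [set t | forall i, `|tnth t i| <= c].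

Arguments cube : clear implicits.

Lemma measurable_cube n c : measurable (cube n c).
Proof.
have -> : cube n c = \bigcap_(i in [set: 'I_n]) ((@tnth n RT)^~ i @^-1` `[- c, c]).
  apply/seteqP; split => t h i; first by move=> _ /=; rewrite in_itv/= -ler_norml.
  by have /= := h i I; rewrite in_itv/= -ler_norml.
apply: fin_bigcap_measurable => // i _; rewrite -[X in measurable X]setTI.
by apply: measurable_tnth => //; exact: measurable_itv.
Qed.

Lemma lebesgue_tuple_cube n (c : R) : 0 <= c ->
  lebesgue_tuple n (cube n c) = ((c *+ 2) ^+ n)%:E.
Proof.
move=> c0; elim: n => [|n IHn].
  by rewrite /= diracE mem_set// => -[].
rewrite [LHS]/= /lebesgue_cons /pushforward.
rewrite (_ : _ @^-1` _ = `[- c, c]%classic `*` cube n c).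
  rewrite product_measure1E//; last exact: measurable_cube.
  rewrite [X in (X * _)%E]lebesgue_measure_itv/= lte_fin IHn -EFinB opprK -mulr2n exprS EFinM.
  have [//|cc] := ltP (- c) c.
  by rewrite (_ : c = 0) ?mul0rn ?mul0e//; lra.
apply/seteqP; split => -[x t] /=.
  move=> h; split; first by have := h ord0; rewrite in_itv/= tnth0 ler_norml.
  by move=> i; have := h (lift ord0 i); rewrite tnthS.
rewrite in_itv/= -ler_norml => -[hx ht] i.
by case: (unliftP ord0 i) => [j|] ->; rewrite ?tnthS ?tnth0//; exact: ht.
Qed.

Lemma lebesgue_volE n (E : set 'cV[R]_n) : measurable (colvec @^-1` E) ->
  lebesgue_vol E = lebesgue_tuple n (colvec @^-1` E).
Proof. exact: measurable_mu_extE. Qed.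

Lemma unit_ballE n (v : 'cV[R]_n) : unit_ball v = (\sum_i v i 0 ^+ 2 <= 1).
Proof.
rewrite /unit_ball /= mxE; congr (is_true (_ <= _)).
by apply: eq_bigr => i _; rewrite mxE expr2.
Qed.

Lemma measurable_unit_ball n : measurable (colvec @^-1` unit_ball : set (n.-tuple RT)).
Proof.
have := measurable_sublevel (1%:M : 'M[R]_n); congr measurable.
by apply/seteqP; split => t /=; rewrite mulmx1.
Qed.

(** Without this, the normalizing factor in the definition of the volume, which
    goes through the real part of an extended real, could be a junk value. *)
Lemma lebesgue_vol_unit_ball n :
  exists2 c : R, 0 < c & lebesgue_vol (@unit_ball R n) = c%:E.
Proof.
rewrite lebesgue_volE; last exact: measurable_unit_ball.
set m := lebesgue_tuple n _.
(* The cube of half-side 1/(n+1) lies in the ball, since n/(n+1)^2 <= 1. *)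
have m_lb : (((n.+1%:R^-1 *+ 2) ^+ n)%:E <= m)%E.
  rewrite -lebesgue_tuple_cube ?invr_ge0//; apply: le_measure; rewrite ?inE.
  - exact: measurable_cube.
  - exact: measurable_unit_ball.
  - move=> t ht; rewrite /preimage /mkset unit_ballE.
    have : \sum_i colvec t i 0 ^+ 2 <= \sum_(i < n) n.+1%:R^-1 :> R.
      apply: ler_sum => i _; rewrite mxE -real_normK ?num_real// expr2.
      rewrite -[leRHS]mulr1; apply: ler_pM => //.
      by rewrite (le_trans (ht i))// invf_le1 ?ler1n ?ltr0n.
    move/le_trans; apply; rewrite sumr_const card_ord -[leLHS]mulr_natl.
    by rewrite ler_pdivrMr ?ltr0n// mul1r ler_nat.
have m_ub : (m <= ((1 *+ 2) ^+ n)%:E)%E.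
  rewrite -lebesgue_tuple_cube//; apply: le_measure; rewrite ?inE.
  - exact: measurable_unit_ball.
  - exact: measurable_cube.
  - move=> t; rewrite /preimage /mkset unit_ballE => ht i.
    rewrite -(@ler_pXn2r _ 2) ?nnegrE// expr1n real_normK ?num_real//.
    apply: le_trans ht; rewrite (bigD1 i)//= mxE lerDl sumr_ge0// => j _.
    exact: sqr_ge0.
have mfin : m \is a fin_num.
  by rewrite ge0_fin_numE ?measure_ge0// (le_lt_trans m_ub)// ltry.
exists (fine m); last by rewrite fineK.
by rewrite -lte_fin fineK// (lt_le_trans _ m_lb)// lte_fin exprn_gt0.
Qed.

End NullAndBall.

(** * Volume of ellipsoids *)

Section EllipsoidVolume.
Context {R : realType}.

Definition posdef n (G : 'M[R]_n) : Prop :=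
  G^T = G /\ forall v : 'cV[R]_n, v != 0 -> 0 < (v^T *m G *m v) 0 0.

(** Eliminate the first coordinate: the form G restricted to the vectors whose
    first coordinate minimizes it is the Schur complement of the upper left
    entry, which is thus positive definite again and factors by induction. *)
Lemma cholesky n (G : 'M[R]_n) : posdef G ->
  exists L : 'M[R]_n, [/\ is_trig_mx L, forall i, 0 < L i i & L *m L^T = G].
Proof.
elim: n => [|n IHn] in G *.
  move=> _; exists 0; split; first by apply/is_trig_mxP => -[].
    by case.
  by rewrite [RHS]flatmx0 [LHS]flatmx0.
rewrite -[n.+1]/(1 + n)%N in G *.
move=> [symG posG].
pose g := G ord0 ord0; pose c : 'cV[R]_n := dlsubmx G; pose G' : 'M[R]_n := drsubmx G.
have EG : G = block_mx g%:M c^T c G'.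
  rewrite -[G in LHS]submxK; congr (block_mx _ _ _ _).
    by apply/matrixP => i j; rewrite !ord1 !mxE mulr1n; congr (G _ _); exact/val_inj.
  by rewrite /c trmx_dlsub symG.
have formE (v : 'cV[R]_(1 + n)) :
    (v^T *m G *m v) 0 0 = ((usubmx v)^T *m (g *: usubmx v + c^T *m dsubmx v)) 0 0 +
      ((dsubmx v)^T *m (c *m usubmx v + G' *m dsubmx v)) 0 0.
  rewrite -mulmxA -[v in LHS]vsubmxK EG mul_block_col tr_col_mx mul_row_col mul_scalar_mx.
  by rewrite [LHS]mxE.
have g0 : 0 < g.
  have /posG : col_mx (1%:M : 'M[R]_1) 0 != 0 :> 'cV[R]_(1 + n).
    rewrite col_mx_eq0 eqxx andbT; apply/eqP => /matrixP/(_ 0 0)/eqP.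
    by rewrite !mxE eqxx oner_eq0.
  rewrite formE col_mxKu col_mxKd !mulmx0 trmx0 mul0mx !addr0 tr_scalar_mx mul1mx.
  by rewrite !mxE /= mulr1n mulr1 addr0.
have gn0 : g != 0 by rewrite gt_eqF.
have symG' : G'^T = G' by rewrite /G' trmx_drsub symG.
(* The Schur complement of g. *)
pose S := G' - g^-1 *: (c *m c^T).
have posS : posdef S.
  split; first by rewrite /S linearB/= linearZ/= trmx_mul trmxK symG'.
  (* The value of the first coordinate that minimizes the form for given w. *)
  move=> w w0; pose x : 'M[R]_1 := - (g^-1 *: (c^T *m w)).
  have /posG : col_mx x w != 0 by rewrite col_mx_eq0 negb_and w0 orbT.
  rewrite formE col_mxKu col_mxKd.
  have -> : g *: x + c^T *m w = 0.
    by rewrite /x scalerN scalerA mulfV// scale1r addNr.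
  have -> : c *m x + G' *m w = S *m w.
    by rewrite /S mulmxBl -scalemxAl -mulmxA /x mulmxN -scalemxAr addrC.
  by rewrite mulmx0 [X in X + _]mxE add0r mulmxA.
have [L' [trL' posL' LL']] := IHn _ posS.
pose l := Num.sqrt g; have l0 : 0 < l by rewrite sqrtr_gt0.
have ll : l * l = g by rewrite -expr2 sqr_sqrtr// ltW.
have ln0 : l != 0 by rewrite gt_eqF.
exists (block_mx l%:M 0 (l^-1 *: c) L'); split.
- apply/is_trig_mxP => i j.
  case: (split_ordP i) => i' ->; case: (split_ordP j) => j' -> /=.
  + by rewrite !ord1.
  + by rewrite block_mxEur mxE.
  + by rewrite ord1 /=.
  + by rewrite block_mxEdr ltn_add2l; exact: (is_trig_mxP trL').
- move=> i; case: (split_ordP i) => i' ->.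
    by rewrite block_mxEul mxE eqxx mulr1n.
  by rewrite block_mxEdr.
- rewrite tr_block_mx mulmx_block !tr_scalar_mx !trmx0 !mul0mx !mulmx0 !addr0.
  rewrite -scalar_mxM ll mul_scalar_mx linearZ/= scalerA mulfV// scale1r.
  rewrite mul_mx_scalar scalerA mulfV// scale1r -scalemxAl -scalemxAr scalerA -invfM ll.
  by rewrite LL' /S addrC subrK -EG.
Qed.

Lemma posdef_unitmx n (G : 'M[R]_n) : posdef G -> G \in unitmx.
Proof.
move=> [symG posG]; rewrite -row_free_unit -kermx_eq0; apply/rowV0P => v.
move=> /sub_kermxP vG; apply/eqP; apply: contraT => v0.
have /posG : v^T != 0 by rewrite trmx_eq0.
by rewrite trmxK vG mul0mx mxE ltxx.
Qed.

Definition ellipsoid n (G : 'M[R]_n) : set 'cV[R]_n :=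
  [set y | (y^T *m invmx G *m y) 0 0 <= 1].

(** If G = L L^T, the preimage of the ellipsoid under L is the unit ball. *)
Lemma volume_ellipsoid n (G : 'M[R]_n) : posdef G ->
  (volume (ellipsoid G) ^+ 2 = (\det G)%:E)%E.
Proof.
move=> pG; have [L [trL posL LL]] := cholesky pG.
have detG : \det G = \det L ^+ 2 by rewrite -LL det_mulmx det_tr expr2.
have detL0 : 0 < \det L by rewrite det_trig// prodr_gt0.
have LGL : L^T *m invmx G *m L = 1%:M.
  by apply: mulmx1C; rewrite mulmxA LL mulmxV// posdef_unitmx.
have [c c0 cE] := @lebesgue_vol_unit_ball R n.
have ballE : lebesgue_vol (@unit_ball R n) =
    ((\det L)^-1%:E * lebesgue_vol (ellipsoid G))%E.
  rewrite !lebesgue_volE; [|exact: measurable_sublevel|exact: measurable_unit_ball].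
  rewrite -(lebesgue_tuple_trig 0 trL posL); last exact: measurable_sublevel.
  congr (lebesgue_tuple n (colvec @^-1` _)); apply/funext => v.
  rewrite /unit_ball /ellipsoid /= addr0 trmx_mul !mulmxA -(mulmxA v^T).
  by rewrite -(mulmxA v^T) LGL mulmx1.
have volE : lebesgue_vol (ellipsoid G) = (\det L * c)%:E.
  by rewrite EFinM -cE ballE muleA -EFinM mulfV ?gt_eqF// mul1e.
rewrite /volume cE volE /= -EFinM mulfK ?gt_eqF//.
by rewrite detG.
Qed.

(** The volume is defined through an outer measure, so E itself need not be
    measurable; this matters for the image of a sublevel set of hc. *)
Lemma volume_negligible n (E E' N : set 'cV[R]_n) :
  (lebesgue_tuple n).-negligible (colvec @^-1` N) ->
  E `<=` E' -> E' `<=` E `|` N -> volume E = volume E'.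
Proof.
move=> [M [mM M0 NM]] EE' E'EN; rewrite /volume; congr (_ * _)%E.
apply/eqP; rewrite eq_le; apply/andP; split.
  by apply: le_mu_ext => t; exact: EE'.
have : (lebesgue_vol E' <= mu_ext (lebesgue_tuple n) (colvec @^-1` E `|` M))%E.
  by apply: le_mu_ext => t /E'EN[|/NM]; [left|right].
move=> /le_trans; apply; apply: le_trans (outer_measureU2 _ _ _) _.
by rewrite [X in (_ + X)%E](_ : _ = 0%E) ?adde0// -M0; exact: measurable_mu_extE.
Qed.

End EllipsoidVolume.

(** * Least-norm solutions and closed-loop maps *)

Section SquaredNorm.
Context {R : realType}.

Lemma unitmxX n (M : 'M[R]_n) k : M \in unitmx -> M ^+ k \in unitmx.
Proof.
by move=> uM; elim: k => [|k IHk]; rewrite ?unitmx1// exprS -mulmxE unitmx_mul uM.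
Qed.

Lemma sqnormE n (u : 'cV[R]_n) : (u^T *m u) 0 0 = \sum_i u i 0 ^+ 2.
Proof. by rewrite mxE; apply: eq_bigr => i _; rewrite mxE expr2. Qed.

Lemma sqnorm_ge0 n (u : 'cV[R]_n) : 0 <= (u^T *m u) 0 0.
Proof. by rewrite sqnormE sumr_ge0// => i _; exact: sqr_ge0. Qed.

Lemma sqnorm_eq0 n (u : 'cV[R]_n) : (u^T *m u) 0 0 = 0 -> u = 0.
Proof.
move=> /eqP; rewrite sqnormE psumr_eq0 => [/allP u0|i _]; last exact: sqr_ge0.
apply/colP => i; rewrite mxE; apply/eqP; rewrite -sqrf_eq0.
by apply: u0; rewrite mem_index_enum.
Qed.

(** The vector u below is the least-norm solution of M u = y. *)
Lemma least_norm_cost m n (M : 'M[R]_(m, n)) (y : 'cV[R]_m) :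
  M *m M^T \in unitmx ->
  let u := M^T *m (invmx (M *m M^T) *m y) in
  (u^T *m u) 0 0 = (y^T *m invmx (M *m M^T) *m y) 0 0.
Proof.
move=> uG /=; set G := M *m M^T.
have symG : (invmx G)^T = invmx G by rewrite trmx_inv trmx_mul trmxK.
congr (fun_of_matrix _ 0 0); rewrite !trmx_mul trmxK symG.
by rewrite !mulmxA -(mulmxA (y^T *m invmx G) M) -/G mulmxKV.
Qed.

(** The input u splits as the least-norm solution plus an element of the kernel
    of M, and the two are orthogonal. *)
Lemma least_norm_le m n (M : 'M[R]_(m, n)) (u : 'cV[R]_n) :
  M *m M^T \in unitmx ->
  ((M *m u)^T *m invmx (M *m M^T) *m (M *m u)) 0 0 <= (u^T *m u) 0 0.
Proof.
move=> uG; rewrite -least_norm_cost//=; set y := M *m u.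
set us := M^T *m _.
have [w Mw ->] : exists2 w, M *m w = 0 & u = us + w.
  exists (u - us); last by rewrite addrC subrK.
  by rewrite mulmxBr /us mulmxA mulKVmx// subrr.
have usw : us^T *m w = 0 by rewrite /us trmx_mul trmxK -mulmxA Mw mulmx0.
have wus : w^T *m us = 0 by rewrite -[LHS]trmxK trmx_mul trmxK usw trmx0.
rewrite [(us + w)^T]linearD/= mulmxDl !mulmxDr usw wus addr0 add0r [leRHS]mxE lerDl.
exact: sqnorm_ge0.
Qed.

(** If v^T M M^T v = 0, then v^T M = 0, and so v^T (M N) = 0. *)
Lemma gram_posdef m n (M : 'M[R]_(m, n)) (N : 'M[R]_(n, m)) :
  M *m N \in unitmx -> posdef (M *m M^T).
Proof.
move=> uMN; split; first by rewrite trmx_mul trmxK.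
move=> v v0.
have -> : v^T *m (M *m M^T) *m v = (M^T *m v)^T *m (M^T *m v).
  by rewrite trmx_mul trmxK !mulmxA.
rewrite lt_neqAle sqnorm_ge0 andbT eq_sym; apply: contra v0 => /eqP/sqnorm_eq0 Mv0.
have : v^T *m (M *m N) = 0 by rewrite mulmxA -[v^T *m M]trmxK trmx_mul trmxK Mv0 trmx0 mul0mx.
move=> /(congr1 (mulmx^~ (invmx (M *m N)))); rewrite mul0mx mulmxK// => vT0.
by rewrite -[v]trmxK vT0 trmx0.
Qed.

End SquaredNorm.

Section ClosedLoopMaps.
Context {R : realType} (Nx Nu T : nat) (A : 'M[R]_Nx) (B : 'M[R]_(Nx, Nu)).
Local Notation dim := (\sum_(t < T) Nx + \sum_(t < T) Nu)%N.

Section Stack.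
Context (k : nat).
Implicit Types (phi : 'M[R]_(dim, k)) (init : 'M[R]_(Nx, k)).

Lemma ZAB0_row phi (s : 'I_T.+1) :
  submxcol (ZAB0 T A B *m phi) s =
  \sum_(t < T | s == t :> nat) state phi t -
  \sum_(t < T | s == t.+1 :> nat) (A *m state phi t + B *m input phi t).
Proof.
rewrite /ZAB0 -[phi in LHS]vsubmxK mul_row_col.
rewrite -[usubmx phi]submxcolK -[dsubmx phi]submxcolK !mul_mxblock_mxrow.
rewrite submxcolD !mxcolK [in RHS]big_mkcond [X in _ - X]big_mkcond/=.
rewrite -!sumrB -big_split/=; apply: eq_bigr => t _.
rewrite -/(state phi t) -/(input phi t) mulmxBl.
by do 2 case: ifP => _; rewrite ?mul1mx ?mul0mx ?mulNmx ?addr0 ?subr0 ?opprD ?addrA.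
Qed.

Lemma steers_ZAB0 init phi : (0 < T)%N -> steers A B init phi <->
  ZAB0 T A B *m phi = \mxcol_(s < T.+1) (if s == 0 :> nat then init else 0).
Proof.
move=> T_gt0.
have sum_at (F : 'I_T -> 'M[R]_(Nx, k)) (s : nat) (t : 'I_T) : s = t ->
    \sum_(i < T | s == i) F i = F t.
  by move=> st; apply: big_pred1 => i; rewrite st eq_sym.
have sum_after (F : 'I_T -> 'M[R]_(Nx, k)) (s : nat) (t : 'I_T) : s = t.+1 ->
    \sum_(i < T | s == i.+1) F i = F t.
  by move=> st; apply: big_pred1 => i; rewrite st eqSS eq_sym.
split=> [[phi0 phiS phiT]|Zphi].
  apply/mxcolP => s; rewrite mxcolK ZAB0_row.
  have := ltn_ord s; case: (nat_of_ord s) => [_|m]; last rewrite ltnS => mT.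
    by rewrite (sum_at _ _ (Ordinal T_gt0))// big_pred0// subr0; exact: phi0.
  rewrite (sum_after _ _ (Ordinal mT))//=.
  have [SmT|TSm] := ltnP m.+1 T.
    by rewrite (sum_at _ _ (Ordinal SmT))// (phiS _ (Ordinal mT))// subrr.
  rewrite phiT ?subr0; last by apply/eqP; rewrite eqn_leq mT.
  by apply: big_pred0 => i; rewrite gtn_eqF// (leq_trans (ltn_ord i)).
have row (s : 'I_T.+1) : \sum_(t < T | s == t :> nat) state phi t -
    \sum_(t < T | s == t.+1 :> nat) (A *m state phi t + B *m input phi t)
    = if s == 0 :> nat then init else 0 by rewrite -ZAB0_row Zphi mxcolK.
split=> [t t0|s t st|t tT].
- by have := row ord0; rewrite (sum_at _ _ t)// big_pred0// subr0.
- have := row (widen_ord (leqnSn T) s); rewrite (sum_at _ _ s)// (sum_after _ _ t)//=.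
  by rewrite st/= => /eqP; rewrite subr_eq0 => /eqP.
- have := row ord_max; rewrite (sum_after _ _ t)// big_pred0 ?gtn_eqF// => [|i].
    by rewrite sub0r => /eqP; rewrite oppr_eq0 => /eqP.
  by rewrite gtn_eqF.
Qed.

End Stack.

Lemma steersD k (init init' : 'M[R]_(Nx, k)) (phi phi' : 'M[R]_(dim, k)) :
  (0 < T)%N -> steers A B init phi -> ZAB0 T A B *m phi' = 0 ->
  steers A B init (phi + phi').
Proof.
move=> T_gt0 /(steers_ZAB0 _ _ T_gt0) Zphi Zphi'; apply/(steers_ZAB0 _ _ T_gt0).
by rewrite mulmxDr Zphi Zphi' addr0.
Qed.

Lemma steersM k l (init : 'M[R]_(Nx, k)) (phi : 'M[R]_(dim, k)) (x : 'M[R]_(k, l)) :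
  steers A B init phi -> steers A B (init *m x) (phi *m x).
Proof.
have stateM t : state (phi *m x) t = state phi t *m x.
  by rewrite /state -mul_usub_mx submxcol_mul.
have inputM t : input (phi *m x) t = input phi t *m x.
  by rewrite /input -mul_dsub_mx submxcol_mul.
move=> [phi0 phiS phiT]; split=> [t t0|s t st|t tT].
- by rewrite stateM phi0.
- by rewrite !stateM inputM (phiS _ _ st) mulmxDl !mulmxA.
- by rewrite stateM inputM !mulmxA -mulmxDl phiT// mul0mx.
Qed.

Lemma Zh_id k (w : 'M[R]_(dim, k)) : ZAB0 T A B *m w = 0 -> Zh T A B *m w = w.
Proof. by move=> Zw; rewrite /Zh mulmxBl mul1mx -mulmxA Zw mulmx0 subr0. Qed.

Lemma ZAB0_Zh : ZAB0 T A B *m Zh T A B = 0.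
Proof.
by rewrite /Zh mulmxBr mulmx1 mulmxA; have [-> _ _ _] := pinvP (ZAB0 T A B); rewrite subrr.
Qed.

Context (C : {set 'I_dim * 'I_Nx}).

(** Row j of Z_h is one of the rows annihilated by H_i: this is what makes the
    columns of Z_h H_i admissible perturbations of column i. *)
Lemma Zh_Hblock_support i j : (j, i) \in C -> row j (Zh T A B *m Hblock A B C i) = 0.
Proof.
move=> jiC; have jR : j \in Rset C i by rewrite inE.
pose r := enum_rank_in jR j.
have ZrH : Zh_rows A B C i *m Hblock A B C i = 0.
  rewrite /Hblock mulmxBr mulmx1 mulmxA.
  by have [-> _ _ _] := pinvP (Zh_rows A B C i); rewrite subrr.
have -> : row j (Zh T A B *m Hblock A B C i) = row r (Zh_rows A B C i *m Hblock A B C i).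
  rewrite !row_mul; congr (_ *m _); apply/rowP => l.
  by rewrite !mxE enum_rankK_in.
by rewrite ZrH row0.
Qed.

(** The difference w between a trajectory of S(x0) and phi0 x0 lies in the kernel
    of Z, so by the rank hypothesis w = sum_i Z_h H_i y_i.  Adding
    x0_i^-1 Z_h H_i y_i to column i of phi0 produces a closed-loop map that
    realizes the trajectory. *)
Lemma trajT_eq_trajS (x0 : 'cV[R]_Nx) : (0 < T)%N ->
  (exists phi, closed_loop A B C phi) ->
  \rank (Zh T A B) = \rank (Zh T A B *m Hmx A B C) ->
  (forall i, x0 i 0 != 0) ->
  trajT A B C x0 = trajS T A B x0.
Proof.
move=> T_gt0 [phi0 [steers0 supp0]] rankZH x0_neq0.
apply/seteqP; split=> [_ [phi [steers_phi _] <-]|v steers_v].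
  by rewrite /trajS /= -[x0 in steers _ _ x0]mul1mx; exact: steersM.
(* Equality of the ranks turns the inclusion of column spaces into equality. *)
have [Y ZhE] : exists Y, Zh T A B = Zh T A B *m Hmx A B C *m Y.
  have sub : ((Zh T A B *m Hmx A B C)^T <= (Zh T A B)^T)%MS.
    by rewrite trmx_mul submxMl.
  have [_] := mxrank_leqif_sup sub; rewrite !mxrank_tr -rankZH eqxx => /esym/submxP[D DE].
  by exists D^T; rewrite -[LHS]trmxK DE trmx_mul trmxK.
pose w := v - phi0 *m x0.
have Zw : ZAB0 T A B *m w = 0.
  have /(steers_ZAB0 _ _ T_gt0) Zv := steers_v.
  have /(steers_ZAB0 _ _ T_gt0) Zphi := steersM x0 steers0.
  by rewrite mulmxBr Zv Zphi mul1mx subrr.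
pose y i := submxcol (Y *m w) i.
have wE : w = \sum_i Zh T A B *m Hblock A B C i *m y i.
  rewrite -[LHS]Zh_id// {1}ZhE -!mulmxA -[Y *m w]submxcolK mul_mxrow_mxcol mulmx_sumr.
  by apply: eq_bigr => i _; rewrite mulmxA.
pose Lam : 'M[R]_(dim, Nx) :=
  \matrix_(j, i) ((x0 i 0)^-1 * (Zh T A B *m Hblock A B C i *m y i) j 0).
have Lamx : Lam *m x0 = w.
  apply/colP => j; rewrite mxE [in RHS]wE summxE; apply: eq_bigr => i _.
  by rewrite mxE mulrAC mulVf ?mul1r.
have ZLam : ZAB0 T A B *m Lam = 0.
  apply/matrixP => s i; rewrite [RHS]mxE.
  have LamE : col i Lam = (x0 i 0)^-1 *: (Zh T A B *m Hblock A B C i *m y i).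
    by apply/colP => j; rewrite !mxE.
  transitivity ((ZAB0 T A B *m col i Lam) s 0).
    by rewrite colE mulmxA -colE [RHS]mxE.
  by rewrite LamE -scalemxAr !(mulmxA (ZAB0 T A B)) ZAB0_Zh !mul0mx scaler0 mxE.
exists (phi0 + Lam); last by rewrite mulmxDl Lamx /w addrC subrK.
split; first exact: steersD.
move=> j i jiC; rewrite mxE supp0// add0r mxE.
have := congr1 (mulmx^~ (y i)) (Zh_Hblock_support jiC); rewrite mul0mx -row_mul.
by move=> /colP/(_ 0); rewrite !mxE => ->; rewrite mulr0.
Qed.

End ClosedLoopMaps.

(** * Reachability and minimum energy *)

Section Reachability.
Context {R : realType} (Nx Nu T : nat) (A : 'M[R]_Nx) (B : 'M[R]_(Nx, Nu)).
Local Notation dim := (\sum_(t < T) Nx + \sum_(t < T) Nu)%N.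

(** Maps a stacked input to the state that it produces at time T from the zero
    state. *)
Definition reach_mx : 'M[R]_(Nx, \sum_(t < T) Nu) :=
  \mxrow_(t < T) (A ^+ (T - t.+1) *m B).

(** The blocks of the reachability matrix come in decreasing powers of A, whence
    the reversal of the index. *)
Lemma gramian_reach_mx :
  \sum_(i < T) A ^+ i *m B *m B^T *m A^T ^+ i = reach_mx *m reach_mx^T.
Proof.
have trX n : (A ^+ n)^T = A^T ^+ n.
  by elim: n => [|n IHn]; rewrite ?expr0 ?trmx1// exprS exprSr -!mulmxE trmx_mul IHn.
rewrite /reach_mx tr_mxrow mul_mxrow_mxcol (reindex_inj rev_ord_inj)/=.
by apply: eq_bigr => i _; rewrite trmx_mul trX !mulmxA.
Qed.

Section Simulation.
Context (k : nat) (init : 'M[R]_(Nx, k)).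

(** Time ranges over all natural numbers, which makes time T available although
    the stacks stop at time T - 1. *)
Fixpoint simulate (u : nat -> 'M[R]_(Nu, k)) n : 'M[R]_(Nx, k) :=
  if n is m.+1 then A *m simulate u m + B *m u m else init.

Lemma simulateE u n :
  simulate u n = A ^+ n *m init + \sum_(i < n) A ^+ (n - i.+1) *m B *m u i.
Proof.
elim: n => [|n IHn] /=; first by rewrite big_ord0 addr0 expr0 mul1mx.
rewrite IHn big_ord_recr/= subnn expr0 mul1mx addrA mulmxDr exprS -mulmxE mulmxA.
congr (_ + _ + _); rewrite mulmx_sumr; apply: eq_bigr => i _.
by rewrite subSn// exprS -mulmxE !mulmxA.
Qed.

Lemma simulate_reach_mx u :
  simulate u T = A ^+ T *m init + reach_mx *m \mxcol_(t < T) u t.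
Proof.
by rewrite simulateE /reach_mx mul_mxrow_mxcol.
Qed.

Lemma steers_reach_mx (phi : 'M[R]_(dim, k)) : (0 < T)%N ->
  steers A B init phi -> A ^+ T *m init + reach_mx *m dsubmx phi = 0.
Proof.
move=> T_gt0 [phi0 phiS phiT].
pose u n := if insub n is Some t then input phi t else 0.
have uE (t : 'I_T) : u t = input phi t by rewrite /u valK.
have stateE (t : 'I_T) : state phi t = simulate u t.
  case: t => m; elim: m => [|m IHm] mT /=; first exact: phi0.
  by rewrite (phiS _ (Ordinal (ltnW mT)))// IHm -uE.
have -> : dsubmx phi = \mxcol_(t < T) u t.
  by rewrite -[LHS]submxcolK; apply/mxcolP => t; rewrite !mxcolK uE.
have pT : (T.-1 < T)%N by rewrite prednK.
rewrite -simulate_reach_mx; transitivity (simulate u T.-1.+1).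
  by rewrite prednK.
by rewrite -[RHS](phiT (Ordinal pT)) /= ?prednK// stateE -uE.
Qed.

Lemma steers_of_input (u : 'M[R]_(\sum_(t < T) Nu, k)) :
  A ^+ T *m init + reach_mx *m u = 0 ->
  exists2 phi : 'M[R]_(dim, k), steers A B init phi & dsubmx phi = u.
Proof.
move=> reach_u.
pose v n := if insub n is Some t then submxcol u t else 0.
have vE (t : 'I_T) : v t = submxcol u t by rewrite /v valK.
have simT : simulate v T = 0.
  rewrite simulate_reach_mx -[RHS]reach_u; congr (_ + _ *m _).
  by rewrite -[RHS]submxcolK; apply/mxcolP => t; rewrite !mxcolK vE.
exists (col_mx (\mxcol_(t < T) simulate v t) u); last by rewrite col_mxKd.
have stateE t : state (col_mx (\mxcol_(t < T) simulate v t) u) t = simulate v t.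
  by rewrite /state col_mxKu mxcolK.
have inputE t : input (col_mx (\mxcol_(t < T) simulate v t) u) t = v t.
  by rewrite /input col_mxKd vE.
split=> [t t0|s t st|t tT]; rewrite !stateE ?inputE.
- by rewrite t0.
- by rewrite st.
- by rewrite -[LHS]/(simulate v t.+1) tT.
Qed.

End Simulation.

Lemma hc_costE (x0 : 'cV[R]_Nx) (phi : 'M[R]_(dim, Nx)) :
  hc_cost x0 phi = ((dsubmx (phi *m x0))^T *m dsubmx (phi *m x0)) 0 0.
Proof.
rewrite /hc_cost; congr (fun_of_matrix _ 0 0).
have -> : \sum_(i < T) (input phi i)^T *m input phi i = (dsubmx phi)^T *m dsubmx phi.
  by rewrite -[dsubmx phi in RHS]submxcolK tr_mxcol mul_mxrow_mxcol.
by rewrite -mul_dsub_mx trmx_mul !mulmxA.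
Qed.

Context (C : {set 'I_dim * 'I_Nx}) (T_gt0 : (0 < T)%N)
  (feasible : exists phi, closed_loop A B C phi).

(** Feasibility reads A^T = - K phi_u, with A^T the T-th power of A and K the
    reachability matrix, so K has a right inverse when A is invertible. *)
Lemma gramian_posdef : A \in unitmx -> posdef (reach_mx *m reach_mx^T).
Proof.
move=> uA; have [phi [steers_phi _]] := feasible.
apply: (@gram_posdef _ _ _ reach_mx (dsubmx phi)).
have /eqP := steers_reach_mx T_gt0 steers_phi; rewrite mulmx1 addrC addr_eq0 => /eqP ->.
by rewrite unitmxE -scaleN1r detZ unitrM unitrX ?unitrN1//; exact: unitmxX.
Qed.

(** Constrained trajectories are in particular trajectories that reach 0. *)
Lemma hc_ge (x0 : 'cV[R]_Nx) : A \in unitmx ->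
  ((((A ^+ T *m x0)^T *m invmx (reach_mx *m reach_mx^T) *m (A ^+ T *m x0)) 0 0)%:E
    <= hc A B C x0)%E.
Proof.
move=> uA; apply: le_ereal_inf_tmp => _ [phi [steers_phi _] <-].
rewrite lee_fin hc_costE.
have := steers_reach_mx T_gt0 (steersM x0 steers_phi).
rewrite mul1mx => /eqP; rewrite addr_eq0 => /eqP ->.
rewrite [(- _)^T]linearN/= !mulNmx mulmxN opprK.
by apply: least_norm_le; apply: posdef_unitmx; exact: gramian_posdef.
Qed.

(** When no coordinate of x0 vanishes, the minimum-energy trajectory obeys the
    constraints for some closed-loop map. *)
Lemma hc_le (x0 : 'cV[R]_Nx) : A \in unitmx ->
  \rank (Zh T A B) = \rank (Zh T A B *m Hmx A B C) ->
  (forall i, x0 i 0 != 0) ->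
  (hc A B C x0 <=
  (((A ^+ T *m x0)^T *m invmx (reach_mx *m reach_mx^T) *m (A ^+ T *m x0)) 0 0)%:E)%E.
Proof.
move=> uA rankZH x0_neq0.
have uG := posdef_unitmx (gramian_posdef uA).
set y := A ^+ T *m x0.
pose u := reach_mx^T *m (invmx (reach_mx *m reach_mx^T) *m (- y)).
have [v steers_v vE] : exists2 v : 'cV[R]_dim, steers A B x0 v & dsubmx v = u.
  by apply: steers_of_input; rewrite /u mulmxA mulKVmx// subrr.
have : trajT A B C x0 v by rewrite trajT_eq_trajS.
move=> [phi phi_cl phix].
have /le_trans : (hc A B C x0 <= (hc_cost x0 phi)%:E)%E.
  by apply: ereal_inf_lbound; exists phi.
apply; rewrite lee_fin hc_costE phix vE least_norm_cost//.
by rewrite [(- _)^T]linearN/= !mulNmx mulmxN opprK.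
Qed.

Lemma Yc_sqr : A \in unitmx ->
  \rank (Zh T A B) = \rank (Zh T A B *m Hmx A B C) ->
  (Yc A B C ^+ 2 = (Vc T A B)%:E)%E.
Proof.
move=> uA rankZH; rewrite /Vc gramian_reach_mx -volume_ellipsoid; last exact: gramian_posdef.
congr (_ ^+ 2)%E; apply: (@volume_negligible _ _ _ _
    [set y | exists i, (invmx (A ^+ T) *m y) i 0 = 0]).
- by apply: negligible_row_zero; rewrite unitmx_inv unitmxX.
- by move=> _ [x0 /= hx0 <-]; rewrite /ellipsoid /= -lee_fin (le_trans _ hx0)// hc_ge.
move=> y ell_y.
have [[i yi0]|y_neq0] := pselect (exists i, (invmx (A ^+ T) *m y) i 0 = 0).
  by right; exists i.
left; exists (invmx (A ^+ T) *m y); last by rewrite mulKVmx// unitmxX.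
rewrite /=; apply: (le_trans (hc_le uA rankZH _)); last by rewrite mulKVmx ?unitmxX// lee_fin.
by move=> i; apply/eqP => yi0; apply: y_neq0; exists i.
Qed.

End Reachability.

(** * The theorem *)

Theorem corollary10 (R : realType) (Nx Nu T : nat)
    (Nx_gt0 : (0 < Nx)%N) (Nu_gt0 : (0 < Nu)%N) (T_gt0 : (0 < T)%N)
    (A : 'M[R]_Nx) (B : 'M[R]_(Nx, Nu))
    (C : {set 'I_(\sum_(t < T) Nx + \sum_(t < T) Nu) * 'I_Nx})
    (feasible : exists phi, closed_loop A B C phi)
    (rankZH : \rank (Zh T A B) = \rank (Zh T A B *m Hmx A B C)) :
  (forall f : 'cV[R]_(\sum_(t < T) Nx + \sum_(t < T) Nu) -> R,
     convex_function [set: 'cV[R]_(\sum_(t < T) Nx + \sum_(t < T) Nu)] f ->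
     \forall t \ae lebesgue_tuple Nx,
       ereal_inf [set (f v)%:E | v in trajT A B C (colvec t)] =
       ereal_inf [set (f v)%:E | v in trajS T A B (colvec t)]) /\
  (A \in unitmx -> (Vc T A B)%:E = (Yc A B C ^+ 2)%E).
Proof.
split; last by move=> uA; rewrite Yc_sqr.
move=> f _; apply: (negligibleS _ (negligible_row_zero (unitmx1 R Nx))).
move=> t /= neq; apply: contra_notP neq => no_zero; rewrite trajT_eq_trajS// => i.
by apply/eqP => ti0; apply: no_zero; exists i; rewrite mul1mx.
Qed.
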